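(* Let $(N,v)$ be the simple MCST-saving game defined by a 0-1 weighted complete graph $\langle K[N_r],\widetilde w\rangle$, where $N=\{1,\dots,n\}$ and $N_r=N\cup\{r\}$, and assume that every player of $(N,v)$ is non-null. Let $\phi$ be the Shapley value of $(N,v)$ and let $\phi^A=(\phi^A_1,\dots,\phi^A_n)$ be the random vector $\phi^A_i=\frac1M\sum_{m=1}^M\bigl(v(\mathrm{Prc}(\pi^{(m)},i)\cup\{i\})-v(\mathrm{Prc}(\pi^{(m)},i))\bigr)$, where $M$ is a positive integer and $\pi^{(1)},\dots,\pi^{(M)}$ are independent uniformly random permutations of $N$. Then, for any $\varepsilon>0$ and $0<\delta<1$: (1) If $\displaystyle M\ge\frac{n^2(n-1)^4\ln(2/\delta)}{2\varepsilon^2}$, then each player $i\in N$ satisfies $$\Pr\left[\frac{|\phi^A_i-\phi_i|}{\phi_i}<\varepsilon\right]\ge 1-\delta.$$ (2) If $\displaystyle M\ge\frac{n^2(n-1)^4\ln(2n/\delta)}{2\varepsilon^2}$, then $$\Pr\left[\forall i\in N,\ \frac{|\phi^A_i-\phi_i|}{\phi_i}<\varepsilon\right]\ge 1-\delta.$$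
   Context: Let $N=\{1,\dots,n\}$ be a set of players, $r\notin N$ a distinguished node (the root), and $N_r=N\cup\{r\}$. $K[V]$ denotes the undirected complete graph on vertex set $V$. A 0-1 weighted complete graph $\langle K[N_r],\widetilde w\rangle$ consists of $K[N_r]$ together with a weight $\widetilde w(i,j)=\widetilde w(j,i)\in\{0,1\}$ for each edge $\{i,j\}$. For non-empty $S\subseteq N$, $c(S)$ is the minimum of $\sum_{e\in T}\widetilde w(e)$ over all spanning trees $T$ (identified with their edge sets) of $K[S\cup\{r\}]$, and $c(\emptyset)=0$. The pair $(N,c)$ is the simple MCST (minimum cost spanning tree) game. The associated simple MCST-saving game $(N,v)$ is defined by $v(S)=\sum_{i\in S}c(\{i\})-c(S)=\sum_{i\in S}\widetilde w(r,i)-c(S)$, $v(\emptyset)=0$. Player $i$ is a null player of $(N,v)$ if $v(S\cup\{i\})=v(S)$ for all $S\subseteq N\setminus\{i\}$; otherwise $i$ is non-null. (Non-null players have positive Shapley value.) A permutation of $N$ is a bijection $\pi:\{1,\dots,n\}\to N$; $\Pi_N$ is the set of all of them. $\mathrm{Prc}(\pi,i)$ is the set of players preceding $i$ in $\pi$. The Shapley value of $(N,v)$ is $\phi_i=\frac{1}{n!}\sum_{\pi\in\Pi_N}\bigl(v(\mathrm{Prc}(\pi,i)\cup\{i\})-v(\mathrm{Prc}(\pi,i))\bigr)$ for $i\in N$. *)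

(* Defs.v *)
From HB Require Import structures.
From mathcomp Require Import all_boot all_order all_algebra fingroup perm.
From mathcomp Require Import all_classical all_reals all_analysis.

Set Implicit Arguments.
Unset Strict Implicit.
Unset Printing Implicit Defensive.

Import Order.TTheory GRing.Theory Num.Theory.

(* Edges are 2-element sets of vertices, so edge weights are symmetric by      *)
(* construction; the values of a weight function on sets of another size are   *)
(* irrelevant.                                                                 *)
Section SpanningTrees.
Variable V : finType.
Implicit Types (U : {set V}) (T : {set {set V}}).

Definition complete_edges U : {set {set V}} :=
  [set e : {set V} | (e \subset U) && (#|e| == 2)]%SET.

Definition adj T : rel V := fun x y => [set x; y]%SET \in T.

Definition acyclic T : Prop := forall p : seq V, 2 < size p -> ~ ucycle (adj T) p.

Definition spanning_tree U T : Prop :=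
  [/\ T \subset complete_edges U,
      {in U &, forall x y, connect (adj T) x y} &
      acyclic T].

Definition star (r : V) U : {set {set V}} :=
  [set [set r; x]%SET | x in U :\ r]%SET.

Lemma adj_starP r U x y : adj (star r U) x y -> (x == r) || (y == r).
Proof.
case/imsetP=> z _ /setP eqs.
by have := eqs r; rewrite !inE eqxx /= ![r == _]eq_sym.
Qed.

Lemma star_acyclic r U : acyclic (star r U).
Proof.
move=> [|a [|b [|c q]]] // _ /andP[/= /and3P[/adj_starP ab /adj_starP bc]].
rewrite !inE !negb_or => cq /and4P[/and3P[nab nac naq] /andP[nbc nbq] _ _].
have br : b == r.
  case/orP: ab => // /eqP ar; case/orP: bc => // /eqP cr.
  by rewrite ar cr eqxx in nac.
have ncr : c != r by rewrite -(eqP br) eq_sym.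
case: q cq naq nbq => [|d q] /=; rewrite ?andbT.
  by move/adj_starP; rewrite (negPf ncr) -(eqP br) (negPf nab).
case/andP=> /adj_starP; rewrite (negPf ncr) /= => /eqP dr _ _.
by rewrite inE dr (eqP br) eqxx.
Qed.

Lemma star_spanning r U : r \in U -> spanning_tree U (star r U).
Proof.
move=> rU; split; last exact: star_acyclic.
  apply/fintype.subsetP=> e /imsetP[x]; rewrite !inE => /andP[xr xU] ->.
  by rewrite finset.subUset !finset.sub1set rU xU cards2 [r == _]eq_sym xr.
have to_r x : x \in U -> connect (adj (star r U)) x r.
  move=> xU; have [->|xr] := eqVneq x r; first exact: connect0.
  apply: connect1; apply/imsetP; exists x; first by rewrite !inE xr.
  by rewrite finset.setUC.
move=> x y xU yU; apply: connect_trans (to_r x xU) _.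
have sym : symmetric (adj (star r U)) by move=> u v; rewrite /adj finset.setUC.
by rewrite (sym_connect_sym sym) to_r.
Qed.

Definition tree_cost (w : {set V} -> nat) T : nat := \sum_(e in T) w e.

End SpanningTrees.

(* The players are the elements of 'I_n; the root is None. *)
Section MCST.
Variable n : nat.
Implicit Types (w : {set (option 'I_n)} -> nat) (S : {set 'I_n}).

Definition zero_one_weight w : Prop :=
  forall x y : option 'I_n, x != y ->
    w [set x; y]%SET = 0 \/ w [set x; y]%SET = 1.

Definition rooted S : {set (option 'I_n)} := (None |: [set Some i | i in S])%SET.

(* The star at the root only witnesses that spanning trees exist; see
   [mcst_cost_attained] and [mcst_cost_le]. *)
Definition mcst_cost w S : nat :=
  tree_cost w
    [arg min_(T < star None (rooted S) | `[< spanning_tree (rooted S) T >])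
       tree_cost w T].

Lemma mcst_costP w S :
  (exists2 T, spanning_tree (rooted S) T & tree_cost w T = mcst_cost w S) /\
  (forall T, spanning_tree (rooted S) T -> mcst_cost w S <= tree_cost w T).
Proof.
have st0 : `[< spanning_tree (rooted S) (star None (rooted S)) >].
  by apply/asboolP/star_spanning; rewrite !inE.
rewrite /mcst_cost; case: arg_minnP => // T /asboolP stT minT.
by split=> [|T' stT']; [exists T | apply: minT; apply/asboolP].
Qed.

Lemma mcst_cost_attained w S :
  exists2 T, spanning_tree (rooted S) T & tree_cost w T = mcst_cost w S.
Proof. by case: (mcst_costP w S). Qed.

Lemma mcst_cost_le w S T :
  spanning_tree (rooted S) T -> mcst_cost w S <= tree_cost w T.
Proof. by case: (mcst_costP w S) => _; apply. Qed.

Lemma mcst_cost0 w : mcst_cost w finset.set0 = 0.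
Proof.
have [T [/fintype.subsetP sT _ _] <-] := mcst_cost_attained w finset.set0.
rewrite /tree_cost big1 // => e /sT; rewrite !inE => /andP[sub /eqP e2].
have := subset_leq_card sub.
by rewrite e2 /rooted imset0 finset.setU0 cards1.
Qed.

End MCST.

Local Open Scope ring_scope.

Section Games.
Variables (R : realType) (n : nat).
Implicit Types (v : {set 'I_n} -> R) (i : 'I_n) (pi : 'S_n).

Definition mcst_saving (w : {set (option 'I_n)} -> nat) (S : {set 'I_n}) : R :=
  (\sum_(i in S) (mcst_cost w [set i]%SET)%:R) - (mcst_cost w S)%:R.

Definition null_player v i : Prop :=
  forall S : {set 'I_n}, i \notin S -> v (i |: S)%SET = v S.

(* pi maps positions to players. *)
Definition Prc pi i : {set 'I_n} := [set j | ((pi^-1)%g j < (pi^-1)%g i)%N]%SET.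

Definition marginal v pi i : R := v (i |: Prc pi i)%SET - v (Prc pi i).

Definition shapley v i : R := (n`!%:R)^-1 * \sum_(pi : 'S_n) marginal v pi i.

Definition shapley_sample v M (pis : 'I_M -> 'S_n) i : R :=
  M%:R^-1 * \sum_(m < M) marginal v (pis m) i.

End Games.

Section RandomPermutations.
Context {d : measure_display} {T : measurableType d} {R : realType}.
Variable P : probability T R.
Variables n M : nat.
Local Open Scope classical_set_scope.

(* 'S_n carries the discrete sigma-algebra. *)
Definition uniform_perm (X : T -> 'S_n) : Prop :=
  forall s : 'S_n, measurable (X @^-1` [set s]) /\
    P (X @^-1` [set s]) = ((n`!%:R)^-1)%:E.

Definition independent_perms (X : 'I_M -> T -> 'S_n) : Prop :=
  forall (J : {set 'I_M}) (A : 'I_M -> set 'S_n),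
    (P (\bigcap_(m in [set` J]) (X m @^-1` A m)) =
     \prod_(m in J) P (X m @^-1` A m))%E.

End RandomPermutations.

(* Main.v *)
(* With weights in {0, 1} every marginal contribution of the saving game lies in
   [0, n - 1]: v is monotone and nonnegative, and v(S) <= |S| - 1 for nonempty S
   because a spanning tree uses some edge at the root.  If all pairs {i, j} had
   v({i, j}) = 0, contracting i in an optimal tree would show that i is null; so
   a non-null i has marginal contribution >= 1 to some singleton {j}, which is
   exactly the set of predecessors of i in (n - 2)! permutations.  Hence
   phi_i >= 1 / (n (n - 1)), and Hoeffding's inequality with deviation
   eps * phi_i and range n - 1 gives (1); a union bound over the players gives
   (2).  Independence and uniformity make the sample uniform on the finite space
   {ffun 'I_M -> 'S_n}, so all probabilities are cardinality ratios. *)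
Require Import Defs.
From mathcomp Require Import all_boot all_order all_algebra fingroup perm.
From mathcomp Require Import all_classical all_reals all_analysis.
From mathcomp Require Import zify ring lra.

Set Implicit Arguments.
Unset Strict Implicit.
Unset Printing Implicit Defensive.

Import Order.TTheory GRing.Theory Num.Theory.

(** * Auxiliary facts on reachability, sums over images and counting *)

Lemma connect_homo (T1 T2 : finType) (e1 : rel T1) (e2 : rel T2) (f : T1 -> T2) :
  (forall x y, e1 x y -> connect e2 (f x) (f y)) ->
  forall x y, connect e1 x y -> connect e2 (f x) (f y).
Proof.
move=> fe x y /connectP[p + ->] {y}; elim: p x => [|z p IHp] x /=.
  by move=> _; apply: connect0.
by case/andP=> /fe xz /IHp; apply: connect_trans.
Qed.

Lemma leq_sum_imset (I J : finType) (g : I -> J) (A : {set I}) (F : J -> nat) :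
  \sum_(j in g @: A) F j <= \sum_(i in A) F (g i).
Proof.
rewrite [leqRHS](partition_big_imset g); apply: leq_sum => j /imsetP[i iA ->].
by rewrite (bigD1 i) ?iA ?eqxx //= leq_addr.
Qed.

(** Union bound in counting form. *)
Lemma card_exists_le (I A : finType) (B : I -> pred A) :
  (#|[set a | [exists i, B i a]]%SET| <= \sum_i #|[set a | B i a]%SET|)%N.
Proof.
have -> : [set a | [exists i, B i a]]%SET = (\bigcup_i [set a | B i a])%SET.
  apply/setP => a; rewrite inE; apply/existsP/finset.bigcupP.
    by case=> i Ba; exists i => //; rewrite inE.
  by case=> i _; rewrite inE; exists i.
elim/big_ind2: _ => [|S1 k1 S2 k2 h1 h2|//]; first by rewrite cards0.
by apply: leq_trans (leq_card_setU _ _) _; apply: leq_add.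
Qed.

(** * Connecting edge sets, spanning subtrees and contraction *)

Section ConnectedEdgeSets.
Variable V : finType.
Implicit Types (U : {set V}) (T : {set {set V}}) (w : {set V} -> nat).

Definition connects U T : Prop := {in U &, forall x y, connect (adj T) x y}.

Lemma adj_sym T : symmetric (adj T).
Proof. by move=> x y; rewrite /adj finset.setUC. Qed.

Lemma tree_costS w T1 T2 : T1 \subset T2 -> tree_cost w T1 <= tree_cost w T2.
Proof.
move=> s12; rewrite /tree_cost [leqRHS](big_setID T1) /=.
by rewrite (finset.setIidPr s12) leq_addr.
Qed.

Lemma tree_costU1 w e T : tree_cost w (e |: T)%SET <= w e + tree_cost w T.
Proof.
rewrite /tree_cost (big_setID [set e]%SET) /=; apply: leq_add.
  by rewrite (finset.setIidPr _) ?big_set1 ?finset.sub1set ?finset.setU11.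
by apply: tree_costS; apply/fintype.subsetP => x; rewrite !inE => /andP[/negPf->].
Qed.

Lemma tree_cost_edge w e T : e \in T -> w e <= tree_cost w T.
Proof. by move=> eT; rewrite /tree_cost (bigD1 e) //= leq_addr. Qed.

Lemma mem_edge U T x y : T \subset complete_edges U -> [set x; y]%SET \in T ->
  [/\ x \in U, y \in U & x != y].
Proof.
move=> /fintype.subsetP sT /sT; rewrite !inE finset.subUset !finset.sub1set -andbA.
by case/and3P=> [xU yU]; rewrite xU yU cards2; case: (x != y).
Qed.

Lemma edge_complete U x y : x \in U -> y \in U -> x != y ->
  [set x; y]%SET \in complete_edges U.
Proof.
by move=> xU yU xy; rewrite !inE finset.subUset !finset.sub1set xU yU cards2 xy.
Qed.

Lemma adj_connectS T1 T2 : T1 \subset T2 ->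
  subrel (connect (adj T1)) (connect (adj T2)).
Proof.
move=> /fintype.subsetP s12; apply: connect_sub => x y xy.
by apply: connect1; apply: s12.
Qed.

Lemma complete_edgesS U1 U2 :
  U1 \subset U2 -> complete_edges U1 \subset complete_edges U2.
Proof.
move=> s12; apply/fintype.subsetP => e; rewrite !inE => /andP[s1 ->].
by rewrite (fintype.subset_trans s1).
Qed.

Lemma connects_edge U T x y : T \subset complete_edges U -> connects U T ->
  x \in U -> y \in U -> x != y ->
  exists z, [/\ z \in U, z != x & [set x; z]%SET \in T].
Proof.
move=> sT cT xU yU; case/connectP: (cT _ _ xU yU) => [[|z p]] /=.
  by move=> _ ->; rewrite eqxx.
case/andP=> xz _ _ _; exists z.
by case: (mem_edge sT xz) => _ zU; rewrite eq_sym.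
Qed.

(** The rest of the cycle, from [y] through [q] back to [x], is a detour around the removed edge.
    The condition on [q] excludes the two-vertex cycle, which runs over one edge twice. *)
Lemma connects_remove_cycle_edge U T x y q : q != [::] ->
  connects U T -> ucycle (adj T) (x :: y :: q) ->
  connects U (T :\ [set x; y])%SET.
Proof.
set T' := (T :\ _)%SET; move=> q0 cT /andP[/= /andP[xy]].
rewrite rcons_path => /andP[pq lx]; rewrite inE negb_or.
case/and3P=> /andP[nxy xq] yq uq.
have yx : connect (adj T') y x.
  apply/connectP; exists (rcons q x); last by rewrite last_rcons.
  rewrite rcons_path; apply/andP; split.
    (* The edges along [y :: q] avoid [x], so none of them is the removed one. *)
    have nx : all (predC1 x) (y :: q).
      by rewrite /= eq_sym nxy; apply/allP => z zq /=; apply: contraNneq xq => <-.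
    apply: (sub_in_path _ nx pq) => u v; rewrite !inE => ux vx uv.
    rewrite /adj !inE [_ \in T]uv andbT; apply: contraNneq ux => /setP/(_ x).
    by rewrite !inE eqxx /= ![x == _]eq_sym (negPf vx) orbF.
  (* If the closing edge were [[set x; y]], then [y] would be the last vertex of [q], against the
     distinctness of the cycle. *)
  rewrite /adj !inE [_ \in T]lx andbT; apply: contraNneq yq => /setP/(_ y).
  rewrite !inE eqxx orbT [y == x]eq_sym (negPf nxy) orbF => /eqP->.
  by case: q q0 {pq lx xq uq} => //= z q _; rewrite mem_last.
move=> u v uU vU; apply: connect_sub (cT _ _ uU vU) => {uU vU} {}u {}v uv.
have [e|ne] := eqVneq [set u; v]%SET [set x; y]%SET; last first.
  by apply: connect1; rewrite /adj !inE ne [_ \in T]uv.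
have/setP eqs := e; have := eqs u; have := eqs v; rewrite !inE !eqxx orbT /= => vxy uxy.
have xy' : connect (adj T') x y by rewrite (sym_connect_sym (@adj_sym T')).
by case/orP: (esym uxy) => /eqP->; case/orP: (esym vxy) => /eqP->.
Qed.

(** Edges on cycles are deleted until none is left, by induction on the number of edges. Upper
    bounds on [mcst_cost] then only require a connecting edge set, with no check of acyclicity. *)
Lemma connects_spanning_tree U T : T \subset complete_edges U -> connects U T ->
  exists2 T' : {set {set V}}, T' \subset T & spanning_tree U T'.
Proof.
have [m] := ubnP #|T|; elim: m T => // m IHm T leTm sT cT.
have [aT|naT] := pselect (acyclic T); first by exists T.
have [[|x [|y q]]] : exists p, 2 < size p /\ ucycle (adj T) p.
  apply: contrapT => np; apply: naT => p szp cyc.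
  by apply: np; exists p.
- by case.
- by case.
case=> q0 cyc; have {}q0 : q != [::] by case: (q) q0.
have xyT : [set x; y]%SET \in T by case/andP: cyc => /= /andP[].
have sub : (T :\ [set x; y])%SET \subset T by apply: subD1set.
case: (IHm _ _ (fintype.subset_trans sub sT) (connects_remove_cycle_edge q0 cT cyc)).
  by move: leTm; rewrite (cardsD1 [set x; y]%SET T) xyT.
by move=> T' sT' stT'; exists T' => //; apply: fintype.subset_trans sT' sub.
Qed.

Lemma connects_hub U T r : (forall x, x \in U -> connect (adj T) x r) ->
  connects U T.
Proof.
move=> cr x y xU yU; apply: connect_trans (cr x xU) _.
by rewrite (sym_connect_sym (@adj_sym T)) cr.
Qed.

(** Graph contraction along [f]: loops are dropped by the cardinality test, and parallel edges merge
    because the result is a set. *)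
Definition contract (f : V -> V) T : {set {set V}} :=
  [set f @: e | e : {set V} in [set e in T | #|f @: e| == 2]]%SET.

Lemma imset_pair (f : V -> V) x y :
  (f @: [set x; y] = [set f x; f y])%SET.
Proof. by rewrite imsetU !imset_set1. Qed.

(** An edge collapsed by [f] becomes an empty path, which [connect_homo] permits. *)
Lemma contract_connect f T x y :
  connect (adj T) x y -> connect (adj (contract f T)) (f x) (f y).
Proof.
move: x y; apply: connect_homo => x y xy.
have [->|nf] := eqVneq (f x) (f y); first exact: connect0.
apply: connect1; apply/imsetP; exists [set x; y]%SET; last by rewrite imset_pair.
by rewrite inE [_ \in T]xy imset_pair cards2 nf.
Qed.

Lemma contract_edges f U U' T : {in U, forall x, f x \in U'} ->
  T \subset complete_edges U -> contract f T \subset complete_edges U'.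
Proof.
move=> fU /fintype.subsetP sT; apply/fintype.subsetP => e' /imsetP[e].
rewrite !inE => /andP[/sT]; rewrite !inE => /andP[/fintype.subsetP eU _] f2 ->.
by rewrite f2 andbT; apply/fintype.subsetP => _ /imsetP[x /eU xU ->]; apply: fU.
Qed.

Lemma contract_cost f w T :
  tree_cost w (contract f T) <= \sum_(e in T | #|f @: e|%SET == 2) w (f @: e)%SET.
Proof.
apply: leq_trans (leq_sum_imset _ _ _) _.
by rewrite leq_eqVlt; apply/orP; left; apply/eqP/eq_bigl => e; rewrite inE.
Qed.

End ConnectedEdgeSets.

(** * Bounds on minimum spanning tree costs *)

Section SimpleMCST.
Variables (n : nat) (w : {set (option 'I_n)} -> nat).
Implicit Types (i j : 'I_n) (S : {set 'I_n}) (T : {set {set (option 'I_n)}}).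

Let W i := w [set None; Some i]%SET.

Lemma rooted_None S : None \in rooted S.
Proof. by rewrite !inE. Qed.

Lemma rooted_Some S i : (Some i \in rooted S) = (i \in S).
Proof. by rewrite !inE /= mem_imset // => x y []. Qed.

Definition rootedE := (rooted_None, rooted_Some).

Lemma rootedS S1 S2 : S1 \subset S2 -> rooted S1 \subset rooted S2.
Proof. by move=> s12; apply/finset.setUS/imsetS. Qed.

Lemma mcst_cost_le_connects S T : T \subset complete_edges (rooted S) ->
  connects (rooted S) T -> mcst_cost w S <= tree_cost w T.
Proof.
move=> sT cT; have [T' sT' stT'] := connects_spanning_tree sT cT.
exact: leq_trans (mcst_cost_le w stT') (tree_costS w sT').
Qed.

Lemma mcst_cost_le_star S : mcst_cost w S <= \sum_(i in S) W i.
Proof.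
apply: leq_trans (mcst_cost_le w (star_spanning (rooted_None S))) _.
rewrite /tree_cost /star; apply: leq_trans (leq_sum_imset _ _ _) _.
have -> : (rooted S :\ None)%SET = [set Some i | i in S]%SET.
  apply/setP => -[i|]; last by rewrite !inE; apply/esym/imsetP => -[].
  by rewrite !inE.
exact: leq_sum_imset.
Qed.

(** Attach [i] by its root edge to an optimal tree for [S]. This yields the monotonicity of the
    saving game. *)
Lemma mcst_cost_setU1 i S : mcst_cost w (i |: S)%SET <= mcst_cost w S + W i.
Proof.
have [T [sT cT _] <-] := mcst_cost_attained w S.
set E := ([set None; Some i] |: T)%SET.
have sS : rooted S \subset rooted (i |: S)%SET by apply/rootedS/finset.subsetUr.
rewrite addnC; apply: leq_trans (tree_costU1 _ _ _).
apply: mcst_cost_le_connects.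
  rewrite finset.subUset finset.sub1set edge_complete ?rootedE ?finset.setU11 //=.
  exact/(fintype.subset_trans sT)/complete_edgesS.
apply: (@connects_hub _ _ _ None) => -[j|] jS; last exact: connect0.
have [->|ji] := eqVneq j i.
  by apply: connect1; rewrite adj_sym /adj finset.setU11.
apply: (@adj_connectS _ T); first exact: finset.subsetUr.
by move: jS; rewrite rooted_Some finset.in_setU1 (negPf ji) /= => jS; apply: cT; rewrite rootedE.
Qed.

(** An optimal tree must leave the root by some edge, and its cost is at least the weight of that
    edge. *)
Lemma mcst_cost_ge_root_edge S i : i \in S ->
  exists2 j, j \in S & W j <= mcst_cost w S.
Proof.
move=> iS; have [T [sT cT _] <-] := mcst_cost_attained w S.
have [||//|[j|] [jS _ jT]] := connects_edge (x := None) (y := Some i) sT cT.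
- exact: rooted_None.
- by rewrite rooted_Some.
- by exists j; [rewrite -rooted_Some | apply: tree_cost_edge].
- by case: (mem_edge sT jT) => _ _; rewrite eqxx.
Qed.

Lemma mcst_cost1 i : mcst_cost w [set i]%SET = W i.
Proof.
apply/eqP; rewrite eqn_leq; apply/andP; split.
  by apply: leq_trans (mcst_cost_le_star _) _; rewrite big_set1.
have [j] := mcst_cost_ge_root_edge (finset.set11 i).
by rewrite inE => /eqP->.
Qed.

(** Cost of the path from the root through [i] to [j]. *)
Lemma mcst_cost_pair i j : i != j ->
  mcst_cost w [set i; j]%SET <= W i + w [set Some i; Some j]%SET.
Proof.
move=> ij; pose T := ([set None; Some i] |: [set [set Some i; Some j]])%SET.
suff [sT cT] : T \subset complete_edges (rooted [set i; j]%SET) /\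
    connects (rooted [set i; j]%SET) T.
  apply: leq_trans (mcst_cost_le_connects sT cT) _.
  apply: leq_trans (tree_costU1 _ _ _) _.
  by rewrite /tree_cost big_set1.
split.
  rewrite finset.subUset !finset.sub1set !edge_complete //;
  by rewrite rootedE // !inE eqxx ?orbT.
have ir : connect (adj T) (Some i) None.
  by apply: connect1; rewrite adj_sym /adj finset.setU11.
apply: (@connects_hub _ _ _ None) => -[k|] kS; last exact: connect0.
move: kS; rewrite rooted_Some => /finset.set2P[]-> //.
by apply: connect_trans ir; apply: connect1; rewrite adj_sym /adj !inE eqxx orbT.
Qed.

Hypothesis w01 : zero_one_weight w.

Lemma zero_one_le1 (x y : option 'I_n) : x != y -> w [set x; y]%SET <= 1.
Proof. by case/w01 => ->. Qed.

(** Moving [i] onto [k] turns [T] into a connecting edge set for [S]. By the last hypothesis no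
    surviving edge gets heavier, and the weight of the collapsed edges is saved. *)
Lemma zero_one_contract T S i k (f := fun x => if x == Some i then k else x) :
  T \subset complete_edges (rooted (i |: S)%SET) ->
  connects (rooted (i |: S)%SET) T -> i \notin S -> k \in rooted S ->
  (forall y, y \in rooted S -> y != k -> [set Some i; y]%SET \in T ->
     w [set k; y]%SET <= w [set Some i; y]%SET) ->
  mcst_cost w S + \sum_(e in T | #|f @: e|%SET != 2) w e <= tree_cost w T.
Proof.
move=> sT cT iS kS wf.
have fE x : x != Some i -> f x = x by rewrite /f => /negPf->.
have fi : f (Some i) = k by rewrite /f eqxx.
have neq_i x : x \in rooted S -> x != Some i.
  by apply: contraTneq => ->; rewrite rooted_Some.
have fS x : x \in rooted (i |: S)%SET -> f x \in rooted S.
  rewrite /f; case: eqVneq => // xi; case: x xi => [j|]; rewrite !rootedE //.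
  by rewrite finset.in_setU1 => /eqP xi /orP[/eqP ji|//]; case: xi; rewrite ji.
(* [f] is the identity on [rooted S], so the contracted paths keep their endpoints. *)
have ScT : connects (rooted S) (contract f T).
  move=> x y xS yS; rewrite -(fE x) ?neq_i // -(fE y) ?neq_i //.
  apply/contract_connect/cT.
    exact: (fintype.subsetP (rootedS (finset.subsetUr [set i]%SET S))).
  exact: (fintype.subsetP (rootedS (finset.subsetUr [set i]%SET S))).
rewrite /tree_cost [leqRHS](bigID (fun e : {set _} => #|f @: e|%SET == 2)) /= leq_add2r.
apply: leq_trans (mcst_cost_le_connects (contract_edges fS sT) ScT) _.
apply: leq_trans (contract_cost _ _ _) _.
apply: leq_sum => e /andP[eT].
(* Edges at [Some i] are the only ones that move; naming the endpoint [x] lets this claim serve both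
   orientations. *)
have wfi x y : x = Some i -> e = [set x; y]%SET -> x != y -> #|f @: e|%SET == 2 ->
    w (f @: e)%SET <= w e.
  move=> -> eE; rewrite eq_sym => ny; rewrite eE imset_pair fi (fE y) // cards2.
  rewrite eqSS eqb1 eq_sym => yk; apply: wf => //; last by rewrite -eE.
  have [_ + _] : [/\ Some i \in rooted (i |: S)%SET, y \in rooted (i |: S)%SET & Some i != y].
    by apply: (@mem_edge _ _ T); rewrite -?eE.
  by move/fS; rewrite fE.
have : e \in complete_edges (rooted (i |: S)%SET) by apply: (fintype.subsetP sT).
rewrite inE => /andP[_ /cards2P[x [y [xy eE]]]].
have [xi|xi] := eqVneq x (Some i); first exact: (wfi x y xi eE xy).
have [yi|yi] := eqVneq y (Some i).
  by apply: (wfi y x yi); rewrite 1?eq_sym // finset.setUC.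
by rewrite eE imset_pair !fE.
Qed.

(* Contract [i] onto the root if their edge is free; otherwise every edge
   at [i] has weight 1 and contracting [i] onto any neighbour [k] in an optimal
   tree saves the edge between [i] and [k]. *)
Lemma mcst_cost_setU1_eq i S : i \notin S ->
  (forall j, j \in S -> w [set Some i; Some j]%SET = 0 -> W i = 0 /\ W j = 0) ->
  mcst_cost w (i |: S)%SET = mcst_cost w S + W i.
Proof.
move=> iS free; apply/eqP; rewrite eqn_leq mcst_cost_setU1 /=.
have [T [sT cT _] <-] := mcst_cost_attained w (i |: S)%SET.
have [Wi|Wi] := w01 (isT : None != Some i).
  rewrite /W Wi addn0; apply: leq_trans (leq_addr _ _) _; last first.
    apply: (zero_one_contract sT cT iS (rooted_None S)).
    move=> [j|] // jS _ _; rewrite rooted_Some in jS.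
    have ij : Some i != Some j by apply: contraNneq iS => -[->].
    have [wij|->] := w01 ij; last exact: zero_one_le1.
    by rewrite -/(W j); have [_ ->] := free j jS wij.
have [||//|k [kS ki kT]] := connects_edge (x := Some i) (y := None) sT cT.
- by rewrite rooted_Some finset.setU11.
- exact: rooted_None.
have {}kS : k \in rooted S.
  case: k kS ki {kT} => [k|] => [|_ _]; last exact: rooted_None.
  rewrite !rooted_Some finset.in_setU1 => /orP[/eqP->|//].
  by rewrite eqxx.
have wi y : y \in rooted S -> w [set Some i; y]%SET = 1.
  case: y => [j|] yS; last by rewrite finset.setUC.
  rewrite rooted_Some in yS.
  have ij : Some i != Some j by apply: contraNneq iS => -[->].
  have [wij|//] := w01 ij.
  by have [] := free j yS wij; rewrite /W Wi.
apply: leq_trans (zero_one_contract sT cT iS kS _); last first.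
  by move=> y yS yk _; rewrite wi // zero_one_le1 // eq_sym.
rewrite leq_add2l (bigD1 [set Some i; k]%SET) /=; last first.
  by rewrite kT imset_pair eqxx (negPf ki) finset.setUid cards1.
by rewrite /W Wi wi.
Qed.

End SimpleMCST.

(** * Range of the saving game and non-null players *)

Section SavingGame.
Local Open Scope ring_scope.
Variables (R : realType) (n : nat) (w : {set (option 'I_n)} -> nat).
Implicit Types (i j : 'I_n) (S : {set 'I_n}).
Hypothesis w01 : zero_one_weight w.

Let v := mcst_saving R w.
Let W i := w [set None; Some i]%SET.

Lemma mcst_savingE S : v S = (\sum_(i in S) W i)%N%:R - (mcst_cost w S)%:R.
Proof. by rewrite natr_sum; congr (_ - _); apply: eq_bigr => i _; rewrite mcst_cost1. Qed.

Lemma mcst_saving_ge0 S : 0 <= v S.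
Proof. by rewrite mcst_savingE subr_ge0 ler_nat mcst_cost_le_star. Qed.

Lemma mcst_saving1 i : v [set i]%SET = 0.
Proof. by rewrite mcst_savingE big_set1 mcst_cost1 subrr. Qed.

(** The root edge to [j] in an optimal tree pays for [W j], and each of the other members of [S]
    contributes at most 1. *)
Lemma mcst_saving_le S : (0 < n)%N -> v S <= n%:R - 1.
Proof.
move=> n0; rewrite -[1]/(1%:R) -natrB // mcst_savingE lerBlDr -natrD ler_nat.
have [->|[i iS]] := finset.set_0Vmem S; first by rewrite big_set0.
have [j jS Wj] := mcst_cost_ge_root_edge w iS.
rewrite (bigD1 j) //= addnC leq_add //.
rewrite (eq_bigl (mem (S :\ j)%SET)); last by move=> x; rewrite !inE andbC.
apply: (@leq_trans (\sum_(x in (S :\ j)%SET) 1)).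
  by apply: leq_sum => x _; apply: zero_one_le1.
have := max_card S; rewrite sum1_card card_ord (cardsD1 j S) jS; lia.
Qed.

Lemma mcst_saving_setU1 i S : i \notin S ->
  v (i |: S)%SET - v S = (mcst_cost w S + W i)%:R - (mcst_cost w (i |: S)%SET)%:R.
Proof. by move=> iS; rewrite !mcst_savingE big_setU1 //= !natrD; ring. Qed.

Lemma mcst_saving_homo i S : v S <= v (i |: S)%SET.
Proof.
have [iS|iS] := boolP (i \in S).
  by rewrite (finset.setUidPr _) ?finset.sub1set.
by rewrite -subr_ge0 mcst_saving_setU1 // subr_ge0 ler_nat mcst_cost_setU1.
Qed.

Lemma marginal_saving_ge0 pi i : 0 <= marginal v pi i.
Proof. by rewrite subr_ge0 mcst_saving_homo. Qed.

Lemma marginal_saving_le pi i : marginal v pi i <= n%:R - 1.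
Proof.
rewrite -[leRHS]subr0 lerB ?mcst_saving_ge0 // mcst_saving_le //.
exact: leq_trans (ltn_ord i).
Qed.

(** By contraposition: if every pair with [i] saves less than 1, it saves nothing by integrality. A
    free edge between [i] and [j] then forces both root edges to be free, by comparison with the two
    paths of [mcst_cost_pair], so [mcst_cost_setU1_eq] makes [i] null. *)
Lemma nonnull_saving_pair i : ~ null_player v i ->
  exists2 j, j != i & 1 <= v [set i; j]%SET.
Proof.
move=> inn; apply: contrapT => nj; apply: inn => S iS; apply/eqP.
rewrite -subr_eq0 mcst_saving_setU1 // subr_eq0 eqr_nat eq_sym.
apply/eqP/mcst_cost_setU1_eq => // j jS wij.
have ij : i != j by apply: contraNneq iS => ->.
suff [] : W i = 0%N /\ W j = 0%N by [].
have vij : v [set i; j]%SET < 1.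
  by rewrite ltNge; apply/negP => vij; apply: nj; exists j; rewrite 1?eq_sym.
move: vij; rewrite mcst_savingE big_setU1 ?big_set1 ?inE //= ltrBlDr.
rewrite -[1]/(1%:R) -natrD ltr_nat ltnS => vij.
have := mcst_cost_pair w ij; have := mcst_cost_pair w (_ : j != i).
rewrite eq_sym ij [[set j; i]%SET]finset.setUC [[set Some j; _]%SET]finset.setUC.
by rewrite wij -/(W i) -/(W j) => /(_ isT); lia.
Qed.

End SavingGame.

(** * Lower bound on the Shapley value *)

Section ShapleyLowerBound.
Local Open Scope ring_scope.

(** Composing with one fixed [s0] that sends [a] to [i] and [b] to [j] injects the permutations of
    the complement of [[set a; b]] into the set counted. *)
Lemma card_perm_fix2 n (a b i j : 'I_n) : a != b -> i != j ->
  (n.-2`! <= #|[set s : 'S_n | (s a == i) && (s b == j)]|)%N.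
Proof.
move=> ab ij; pose s1 := tperm a i.
have s1b : s1 b != i by rewrite -[i in _ != i](tpermL a i) (inj_eq perm_inj) eq_sym.
pose s0 := (s1 * tperm (s1 b) j)%g.
have s0a : s0 a = i by rewrite permM tpermL tpermD // eq_sym.
have s0b : s0 b = j by rewrite permM tpermL.
have card_ab : #|(~: [set a; b])%SET| = n.-2.
  by rewrite cardsCs finset.setCK cards2 ab card_ord subn2.
rewrite -card_ab -card_perm -(card_imset _ (mulIg s0)) subset_leq_card //.
apply/fintype.subsetP => _ /imsetP[p pab ->]; rewrite inE !permM.
have pa : p a = a by apply: (out_perm pab); rewrite !inE eqxx.
have pb : p b = b by apply: (out_perm pab); rewrite !inE eqxx orbT.
by rewrite pa pb -!permM -/s0 s0a s0b !eqxx.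
Qed.

Lemma Prc_second n (pi : 'S_n) (i j : 'I_n) :
  val (pi^-1 j)%g = 0%N -> val (pi^-1 i)%g = 1%N -> Prc pi i = [set j]%SET.
Proof.
move=> /= j0 i1; apply/setP => x; rewrite !inE i1 ltnS leqn0 -j0.
by rewrite [LHS]val_eqE (inj_eq perm_inj).
Qed.

Lemma shapley_ge_pair (R : realType) n (v : {set 'I_n} -> R) (i j : 'I_n) :
  (forall pi, 0 <= marginal v pi i) -> j != i ->
  1 <= v [set i; j]%SET - v [set j]%SET ->
  (n%:R * (n%:R - 1))^-1 <= shapley v i.
Proof.
move=> m0 ji v1.
have n1 : (1 < n)%N.
  rewrite -[n]card_ord; apply: leq_trans (max_card [set i; j]%SET).
  by rewrite cards2 eq_sym ji.
(* Positions count from 0, so [a] and [b] are the first and second positions. *)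
pose a := Ordinal (ltnW n1); pose b := Ordinal n1.
rewrite /shapley; have nfact : n`!%:R = n%:R * (n%:R - 1) * n.-2`!%:R :> R.
  case: n n1 {v i j m0 ji v1 a b} => [|[|n]] // _.
  by rewrite !factS !natrM /= -natr1 addrK mulrA.
have -> : (n`!%:R)^-1 = (n%:R * (n%:R - 1))^-1 * (n.-2`!%:R)^-1 :> R.
  by rewrite nfact [LHS]invfM.
rewrite -[leLHS]mulr1 -mulrA ler_wpM2l //.
  by rewrite invr_ge0 mulr_ge0 // subr_ge0 ler1n ltnW.
rewrite ler_pdivlMl ?ltr0n ?fact_gt0 // mulr1.
have ab : a != b by [].
apply: le_trans (_ : (#|[set s : 'S_n | (s a == j) && (s b == i)]|)%:R <= _).
  by rewrite ler_nat card_perm_fix2.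
(* Keep only the orders beginning with [j], [i]; each contributes at least 1, and the discarded
   marginals are nonnegative. *)
rewrite [leRHS](bigID (fun s : 'S_n => (s a == j) && (s b == i))) /=.
rewrite -[leLHS]addr0 lerD ?sumr_ge0 // -sum1dep_card natr_sum.
apply: ler_sum => pi /andP[/eqP aj /eqP bi].
by rewrite /marginal (@Prc_second _ _ _ j) // -?aj -?bi permK.
Qed.

End ShapleyLowerBound.

(** * Hoeffding's inequality by counting on a finite product space *)

Section Hoeffding.
Local Open Scope ring_scope.
Variable R : realType.
Implicit Types (p h x : R).

Lemma is_derive_ge0_ndecr (f df : R -> R) :
  (forall x, is_derive x 1 f (df x)) -> (forall x, 0 <= x -> 0 <= df x) ->
  forall x, 0 <= x -> f 0 <= f x.
Proof.
move=> fd dfge0 x x0; apply: (@ger0_derive1_ndecry _ f 0) => //.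
- by move=> y; rewrite in_itv /= andbT => y0; rewrite derive1E derive_val dfge0 // ltW.
- apply: derivable_within_continuous => y _.
  by have [] := fd y.
Qed.

(* Both sides agree at [h = 0] up to first order, and the logarithm of the left
   side has second derivative [q (1 - q) <= 1/4] where
   [q = p e^h / (1 - p + p e^h)]; [k] is the derivative of the difference of
   the logarithms. *)
Lemma bernoulli_mgf_le p h : 0 <= p <= 1 -> 0 <= h ->
  1 - p + p * expR h <= expR (p * h + h ^+ 2 / 8).
Proof.
move=> /andP[p0 p1] h0.
pose d (x : R) : R := 1 - p + p * expR x.
have dd x : is_derive x 1 d (p * expR x).
  by apply: is_derive_eq; rewrite add0r mul1r.
have dgt0 x : 0 < d x.
  rewrite /d; have ex := expR_gt0 x; have pe := mulr_ge0 p0 (ltW ex).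
  by case: (ltrgtP p 1) p1 => // [p1|->] _; [|rewrite mul1r]; lra.
pose k (x : R) : R := p + x / 4 - p * expR x * (d x)^-1.
have kge0 : forall x : R, 0 <= x -> 0 <= k x.
  have k0 : k 0 = 0.
    by rewrite /k /d expR0 mulr1 subrK invr1 mulr1 mul0r addr0 subrr.
  pose dk y : R := 4^-1 - p * expR y * (1 - p) / (d y) ^+ 2.
  have kd : forall y : R, is_derive y 1 k (dk y).
    move=> y.
    have dV := is_deriveV (lt0r_neq0 (dgt0 y)) (dd y).
    apply: is_derive_eq.
    have := lt0r_neq0 (dgt0 y).
    rewrite /dk /d /GRing.scale /= => dy0; field => //.
  have dk0 : forall y : R, 0 <= y -> 0 <= dk y.
    (* After clearing denominators this is the inequality of arithmetic and geometric means for the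
       two summands of [d y]. *)
    move=> y _; rewrite subr_ge0 ler_pdivrMr ?exprn_gt0 // /d.
    have := sqr_ge0 (1 - p - p * expR y); lra.
  by move=> x x0; rewrite -k0; apply: (is_derive_ge0_ndecr kd dk0).
(* [g] restates the claim without logarithms: [0 <= g h] is the claim divided by its right side, and
   the derivative of [g] is [k] times a positive factor. *)
pose g (x : R) : R := 1 - d x * expR (- (p * x + x ^+ 2 / 8)).
have g0 : g 0 = 0.
  by rewrite /g /d expR0 mulr1 subrK mul1r mulr0 expr0n mul0r addr0 oppr0 expR0 subrr.
pose dg x : R := d x * k x * expR (- (p * x + x ^+ 2 / 8)).
have gd : forall x : R, is_derive x 1 g (dg x).
  move=> x.
  have dx := dd x.
  apply: is_derive_eq.
  have := lt0r_neq0 (dgt0 x).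
  rewrite /dg /k /d /GRing.scale /= => dx0; field => //.
have dg0 : forall x : R, 0 <= x -> 0 <= dg x.
  by move=> x x0; rewrite !mulr_ge0 ?expR_ge0 ?kge0 // ltW.
have : g 0 <= g h by apply: (is_derive_ge0_ndecr gd dg0).
rewrite g0 /g.
by rewrite expRN subr_ge0 ler_pdivrMr ?expR_gt0 // mul1r.
Qed.
(** Convexity of the exponential: the bounds [1 + x <= expR x] at [h - q * h] and [- (q * h)] are
    averaged with weights [q] and [1 - q], and the linear terms cancel. *)
Lemma expR_chord q h : 0 <= q <= 1 -> expR (q * h) <= 1 - q + q * expR h.
Proof.
move=> /andP[q0 q1].
have e1 := expR_ge1Dx (h - q * h); have e2 := expR_ge1Dx (- (q * h)).
have : 1 <= (1 - q + q * expR h) * expR (- (q * h)).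
  rewrite mulrDl -mulrA -expRD.
  have := ler_wpM2l q0 e1; have := ler_wpM2l (_ : 0 <= 1 - q) e2.
  by rewrite subr_ge0 => /(_ q1); lra.
by rewrite expRN ler_pdivlMr ?expR_gt0 // mul1r.
Qed.

Variables (A : finType) (b : R).
Hypotheses (A0 : (0 < #|A|)%N) (b0 : 0 < b).

(** Hoeffding's lemma for the uniform law on [A]. The chord bound is affine in [Y], so its average
    is the generating function of a law on 0 and [b] with the same mean, to which [bernoulli_mgf_le]
    applies. *)
Lemma hoeffding_mgf (Y : A -> R) (mu l : R) :
  (forall a, 0 <= Y a <= b) -> \sum_a Y a = #|A|%:R * mu -> 0 <= l ->
  \sum_a expR (l * (Y a - mu)) <= #|A|%:R * expR (l ^+ 2 * b ^+ 2 / 8).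
Proof.
move=> Yb Ymu l0; have bn0 : b != 0 := lt0r_neq0 b0.
have N0 : 0 < #|A|%:R :> R by rewrite ltr0n.
have p01 : 0 <= mu / b <= 1.
  rewrite ler_pdivlMr // mul0r ler_pdivrMr // mul1r -[0 <= mu](ler_pM2l N0) -[mu <= b](ler_pM2l N0) mulr0 -Ymu.
  rewrite sumr_ge0 /= => [|a _]; last by case/andP: (Yb a).
  by rewrite mulr_natl -sumr_const ler_sum // => a _; case/andP: (Yb a).
have -> : l ^+ 2 * b ^+ 2 / 8 = mu / b * (l * b) + (l * b) ^+ 2 / 8 - l * mu.
  by field.
rewrite expRD mulrA (eq_bigr (fun a => expR (l * Y a) * expR (- (l * mu)))); last first.
  by move=> a _; rewrite -expRD; congr expR; ring.
rewrite -mulr_suml ler_wpM2r ?expR_ge0 //.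
apply: le_trans (_ : #|A|%:R * (1 - mu / b + mu / b * expR (l * b)) <= _); last first.
  by apply: ler_wpM2l (bernoulli_mgf_le p01 (mulr_ge0 l0 (ltW b0))); rewrite ler0n.
have -> : #|A|%:R * (1 - mu / b + mu / b * expR (l * b)) =
    \sum_a (1 + Y a * ((expR (l * b) - 1) / b)).
  by rewrite big_split /= sumr_const -mulr_suml Ymu; field.
apply: ler_sum => a _; have /andP[Y0 Y1] := Yb a.
have Yb01 : 0 <= Y a / b <= 1.
  by rewrite ler_pdivlMr // mul0r Y0 ler_pdivrMr // mul1r.
have := expR_chord (l * b) Yb01.
have -> : Y a / b * (l * b) = l * Y a by field.
by move=> /le_trans; apply; rewrite le_eqVlt; apply/orP; left; apply/eqP; field.
Qed.

Variable M : nat.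

Lemma hoeffding_count_upper (Y : A -> R) (mu t : R) :
  (forall a, 0 <= Y a <= b) -> \sum_a Y a = #|A|%:R * mu -> 0 <= t ->
  #|[set s : {ffun 'I_M -> A} | M%:R * t <= \sum_m (Y (s m) - mu)]%SET|%:R <=
  #|A|%:R ^+ M * expR (- (2 * M%:R * t ^+ 2 / b ^+ 2)).
Proof.
move=> Yb Ymu t0; have bn0 : b != 0 := lt0r_neq0 b0.
(* the minimiser of [l ^+ 2 * b ^+ 2 / 8 - l * t] *)
pose l := 4 * t / b ^+ 2.
have l0 : 0 <= l by apply: divr_ge0 (sqr_ge0 b); apply: mulr_ge0.
(* Chernoff bound: the exponential dominates the indicator of the event. *)
apply: le_trans (_ : \sum_(s : {ffun 'I_M -> A})
    expR (l * (\sum_m (Y (s m) - mu) - M%:R * t)) <= _).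
  rewrite -sum1dep_card natr_sum.
  rewrite [leRHS](bigID (fun s : {ffun 'I_M -> A} =>
    M%:R * t <= \sum_m (Y (s m) - mu))) /= -[leLHS]addr0.
  rewrite lerD ?sumr_ge0 //.
  apply: ler_sum => s ts; rewrite -[leLHS]expR0 ler_expR mulr_ge0 //.
  by rewrite subr_ge0.
(* Independence in counting form: the sum over all samples factors into [M] equal sums over [A]. *)
have -> : \sum_(s : {ffun 'I_M -> A}) expR (l * (\sum_m (Y (s m) - mu) - M%:R * t)) =
    (\sum_a expR (l * (Y a - mu))) ^+ M * expR (- (l * (M%:R * t))).
  rewrite -[M in _ ^+ M]card_ord -prodr_const bigA_distr_bigA mulr_suml /=.
  apply: eq_bigr => s _; rewrite mulrBr mulr_sumr expRD; congr (_ * _).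
  by rewrite expR_sum.
have S0 : 0 <= \sum_a expR (l * (Y a - mu)) by apply: sumr_ge0 => a _; apply: expR_ge0.
have := hoeffding_mgf Yb Ymu l0 => /(lerXn2r M S0) mgf.
apply: le_trans (ler_wpM2r (expR_ge0 _) (mgf _)) _.
  by rewrite nnegrE mulr_ge0 ?expR_ge0.
rewrite exprMn -expRM_natl -[leLHS]mulrA -expRD ler_wpM2l ?exprn_ge0 // ler_expR.
by rewrite le_eqVlt /l; apply/orP; left; apply/eqP; field.
Qed.

(** The lower tail is the upper tail of the reflected variable [b - Y], which has the same range. *)
Lemma hoeffding_count (Y : A -> R) (mu t : R) :
  (forall a, 0 <= Y a <= b) -> \sum_a Y a = #|A|%:R * mu -> 0 <= t ->
  #|[set s : {ffun 'I_M -> A} | M%:R * t <= `|\sum_m (Y (s m) - mu)|]%SET|%:R <=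
  2 * expR (- (2 * M%:R * t ^+ 2 / b ^+ 2)) * #|A|%:R ^+ M.
Proof.
move=> Yb Ymu t0; pose Y' a := b - Y a; pose mu' := b - mu.
have Yb' a : 0 <= Y' a <= b by rewrite subr_ge0 gerBl andbC; apply: Yb.
have Ymu' : \sum_a Y' a = #|A|%:R * mu'.
  by rewrite sumrB sumr_const Ymu mulrBr [#|A|%:R * b]mulr_natl.
have up := hoeffding_count_upper Yb Ymu t0.
have dn := hoeffding_count_upper Yb' Ymu' t0.
rewrite -[leRHS]mulrA [_ * #|A|%:R ^+ M]mulrC [leRHS]mulr_natl mulr2n.
apply: le_trans (lerD up dn); rewrite -natrD ler_nat.
apply: leq_trans (leq_card_setU _ _); apply/subset_leq_card/fintype.subsetP => s.
rewrite !inE ler_normr => /orP[->//|ts]; apply/orP; right.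
apply: le_trans ts _; rewrite -sumrN ler_sum // => m _.
by rewrite /Y' /mu'; lra.
Qed.
End Hoeffding.

(** * Law of the sample of permutations *)

Section IndependentPermutations.
Local Open Scope classical_set_scope.
Local Open Scope ring_scope.
Context {d : measure_display} {T : measurableType d} {R : realType}.
Variables (P : probability T R) (n M : nat) (X : 'I_M -> T -> 'S_n).
Hypothesis X_unif : forall m, uniform_perm P (X m).
Hypothesis X_indep : independent_perms P X.

Let cell (s : {ffun 'I_M -> 'S_n}) : set T := [set t | forall m, X m t = s m].

Let cellE s : cell s = \bigcap_(m in [set` [set: 'I_M]%SET]) (X m @^-1` [set s m]).
Proof.
by apply/seteqP; split => t /= st m; [move=> _; apply: st | apply: st; rewrite /= finset.in_setT].
Qed.

Let measurable_cell s : measurable (cell s).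
Proof.
rewrite cellE; apply: fin_bigcap_measurable => // m _.
by have [] := X_unif m (s m).
Qed.

Let P_cell s : P (cell s) = ((n`!%:R ^+ M)^-1)%:E.
Proof.
rewrite cellE X_indep (eq_bigr (fun=> ((n`!%:R)^-1)%:E)); last first.
  by move=> m _; have [] := X_unif m (s m).
by rewrite prodEFin big_const cardsT card_ord iter_mulr_1 exprVn.
Qed.

(** The event is a finite disjoint union of cells, each fixing all [M] draws, and independence with
    uniformity gives every cell the same probability. *)
Lemma independent_perms_prob (Q : {set {ffun 'I_M -> 'S_n}}) (E : set T) :
  (forall t, E t <-> [ffun m => X m t] \in Q) ->
  P E = (#|Q|%:R / n`!%:R ^+ M)%:E.
Proof.
move=> EQ; have -> : E = \bigcup_(s in [set` enum Q]) cell s.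
  apply/seteqP; split => t.
    by move/EQ => tQ; exists [ffun m => X m t]; [rewrite /= mem_enum | move=> m; rewrite ffunE].
  case=> s /=; rewrite mem_enum => sQ st; apply/EQ; suff -> : [ffun m => X m t] = s by [].
  by apply/ffunP => m; rewrite ffunE st.
rewrite measure_fin_bigcup //; last first.
  apply/trivIsetP => s1 s2 _ _ /eqP s12; apply/seteqP; split => // t [/= t1 t2].
  by apply: s12; apply/ffunP => m; rewrite -t1 -t2.
rewrite (eq_fsbigr (fun=> ((n`!%:R ^+ M)^-1)%:E)); last first.
  by move=> s _; apply: P_cell.
rewrite -fsbig_seq ?enum_uniq // big_enum /= sumEFin sumr_const.
by rewrite -[_ *+ #|Q|]mulr_natl.
Qed.
End IndependentPermutations.

(** * Counting samples with a large relative error *)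

Section RelativeError.
Local Open Scope ring_scope.
Variables (R : realType) (n M : nat).

Lemma card_sample_space : #|{: {ffun 'I_M -> 'S_n}}|%:R = n`!%:R ^+ M :> R.
Proof. by rewrite card_ffun card_Sn card_ord natrX. Qed.

Variables (v : {set 'I_n} -> R) (i : 'I_n) (b eps delta : R).
Hypotheses (M0 : (0 < M)%N) (b0 : 0 < b) (eps0 : 0 < eps) (delta0 : 0 < delta).
Hypothesis marginal_b : forall pi, 0 <= marginal v pi i <= b.
Hypothesis phi_ge : (n%:R * b)^-1 <= shapley v i.

Definition small_error (s : {ffun 'I_M -> 'S_n}) : bool :=
  `|shapley_sample v s i - shapley v i| / shapley v i < eps.

Lemma card_large_error :
  n%:R ^+ 2 * b ^+ 4 * ln (2 / delta) / (2 * eps ^+ 2) <= M%:R ->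
  #|[set s | ~~ small_error s]%SET|%:R <= delta * n`!%:R ^+ M.
Proof.
move=> hM; set phi := shapley v i.
have n0 : 0 < n%:R :> R by rewrite ltr0n (leq_trans _ (ltn_ord i)).
have nb0 : 0 < n%:R * b by rewrite mulr_gt0.
have phi0 : 0 < phi by apply: lt_le_trans phi_ge; rewrite invr_gt0.
have MR0 : 0 < M%:R :> R by rewrite ltr0n.
have Sn0 : (0 < #|{: 'S_n}|)%N by rewrite card_Sn fact_gt0.
have sum_marginal : \sum_pi marginal v pi i = #|{: 'S_n}|%:R * phi.
  by rewrite card_Sn /phi /shapley mulVKf // pnatr_eq0 -lt0n fact_gt0.
have t0 : 0 <= eps * phi by rewrite ltW // mulr_gt0.
(* A large relative error is a deviation of the unnormalised sum by at least [M * eps * phi]. *)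
have -> : [set s | ~~ small_error s]%SET =
    [set s : {ffun 'I_M -> 'S_n} |
      M%:R * (eps * phi) <= `|\sum_m (marginal v (s m) i - phi)|]%SET.
  apply/setP => s; rewrite !inE -leNgt ler_pdivlMr // -/phi.
  have -> : \sum_m (marginal v (s m) i - phi) =
      M%:R * (shapley_sample v s i - phi).
    rewrite sumrB sumr_const card_ord mulrBr /shapley_sample mulVKf ?gt_eqF //.
    by rewrite mulr_natl.
  by rewrite normrM gtr0_norm // ler_pM2l.
apply: le_trans (hoeffding_count Sn0 b0 M marginal_b sum_marginal t0) _.
rewrite card_Sn ler_wpM2r ?exprn_ge0 ?ler0n //.
rewrite expRN ler_pdivrMr ?expR_gt0 // mulrC -ler_pdivrMr //.
rewrite -[leLHS]lnK ?posrE ?divr_gt0 // ler_expR.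
(* The lower bound on [phi] enters here: it removes the unknown [phi] from the Hoeffding exponent at
   the price of the factor [(n * b) ^ 2] in the sample size. *)
have nbphi : 1 <= (n%:R * b * phi) ^+ 2.
  by rewrite exprn_ege1 // -ler_pdivrMl // mulr1.
have e2 : 0 < 2 * eps ^+ 2 by rewrite mulr_gt0 ?exprn_gt0.
rewrite ler_pdivrMr // in hM.
have nb4 : 0 < n%:R ^+ 2 * b ^+ 4 by rewrite mulr_gt0 ?exprn_gt0.
rewrite -(ler_pM2l nb4); apply: le_trans hM _.
have -> : n%:R ^+ 2 * b ^+ 4 * (2 * M%:R * (eps * phi) ^+ 2 / b ^+ 2) =
    M%:R * (2 * eps ^+ 2) * (n%:R * b * phi) ^+ 2.
  by field; apply: lt0r_neq0.
by rewrite ler_peMr // mulr_ge0 // ltW.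
Qed.

End RelativeError.

(** * From counts of bad samples to probabilities of good events *)

Section ProbabilityFromCount.
Local Open Scope ring_scope.
Context {d : measure_display} {T : measurableType d} {R : realType}.
Variables (P : probability T R) (n M : nat) (X : 'I_M -> T -> 'S_n).
Hypothesis X_unif : forall m, uniform_perm P (X m).
Hypothesis X_indep : independent_perms P X.

Lemma independent_perms_prob_ge (Q : pred {ffun 'I_M -> 'S_n}) (delta : R)
    (E : set T) :
  (forall t, E t <-> Q [ffun m => X m t]) ->
  #|[set s | ~~ Q s]%SET|%:R <= delta * n`!%:R ^+ M ->
  ((1 - delta)%:E <= P E)%E.
Proof.
move=> EQ Qdelta; rewrite (independent_perms_prob X_unif X_indep (Q := finset Q)); last first.
  by move=> t; rewrite inE.
have N0 : 0 < n`!%:R ^+ M :> R by rewrite exprn_gt0 // ltr0n fact_gt0.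
rewrite lee_fin ler_pdivlMr // mulrBl mul1r lerBlDr -[leLHS]card_sample_space.
rewrite -(cardsC (finset Q)) natrD lerD2l; apply: le_trans Qdelta.
by rewrite ler_nat subset_leq_card //; apply/fintype.subsetP => s; rewrite !inE.
Qed.

End ProbabilityFromCount.

(** * Error count for the saving game, with range [n - 1] *)

Section SavingGameError.
Local Open Scope ring_scope.
Variables (R : realType) (n M : nat) (w : {set (option 'I_n)} -> nat).
Hypothesis w01 : zero_one_weight w.
Let v := mcst_saving R w.

Lemma card_large_error_saving (i : 'I_n) (eps delta : R) :
  ~ null_player v i -> (0 < M)%N -> 0 < eps -> 0 < delta ->
  n%:R ^+ 2 * (n%:R - 1) ^+ 4 * ln (2 / delta) / (2 * eps ^+ 2) <= M%:R ->
  #|[set s : {ffun 'I_M -> 'S_n} | ~~ small_error v i eps s]%SET|%:R <=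
    delta * n`!%:R ^+ M.
Proof.
move=> inn M0 eps0 delta0; have [j ji vij] := nonnull_saving_pair w01 inn.
apply: card_large_error => //.
(* The partner [j] of a non-null player gives at least two players, so the range [n - 1] is
   positive. *)
- rewrite subr_gt0 ltr1n -[n]card_ord.
  by apply: leq_trans (max_card [set j; i]%SET); rewrite cards2 ji.
- by move=> pi; rewrite marginal_saving_ge0 ?marginal_saving_le.
- apply: (@shapley_ge_pair _ _ _ _ j) => //; last by rewrite [v [set j]%SET]mcst_saving1 subr0.
  by move=> pi; apply: marginal_saving_ge0.
Qed.

End SavingGameError.

(** * The two sample-size bounds *)

Local Open Scope classical_set_scope.
Local Open Scope ring_scope.

Theorem theorem4p4 (R : realType) (n : nat) (w : {set (option 'I_n)} -> nat)
    (hw : zero_one_weight w)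
    (hnull : forall i : 'I_n, ~ null_player (mcst_saving R w) i)
    (d : measure_display) (T : measurableType d) (P : probability T R)
    (M : nat) (hM : (0 < M)%N) (X : 'I_M -> T -> {perm 'I_n})
    (hunif : forall m : 'I_M, uniform_perm P (X m))
    (hindep : independent_perms P X)
    (eps delta : R) (heps : 0 < eps) (hdelta0 : 0 < delta) (hdelta1 : delta < 1) :
  let v := mcst_saving R w in
  let phi := shapley v in
  let phiA := fun (t : T) (i : 'I_n) => shapley_sample v (fun m => X m t) i in
  (n%:R ^+ 2 * (n%:R - 1) ^+ 4 * ln (2 / delta) / (2 * eps ^+ 2) <= M%:R ->
     forall i : 'I_n,
       ((1 - delta)%:E <=
          P [set t | (`|phiA t i - phi i| / phi i < eps)%R])%E)
  /\
  (n%:R ^+ 2 * (n%:R - 1) ^+ 4 * ln (2 * n%:R / delta) / (2 * eps ^+ 2) <= M%:R ->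
     ((1 - delta)%:E <=
        P [set t | forall i : 'I_n, (`|phiA t i - phi i| / phi i < eps)%R])%E).
Proof.
move=> v phi phiA.
have smallE t i : (`|phiA t i - phi i| / phi i < eps) =
    small_error v i eps [ffun m => X m t].
  rewrite /small_error; suff -> : phiA t i = shapley_sample v [ffun m => X m t] i by [].
  by congr (_ * _); apply: eq_bigr => m _; rewrite ffunE.
split=> [hMi i|hMn].
  apply: (independent_perms_prob_ge hunif hindep (Q := small_error v i eps)).
    by move=> t; rewrite /= smallE.
  exact: card_large_error_saving.
apply: (independent_perms_prob_ge hunif hindep
          (Q := fun s => [forall i, small_error v i eps s])).
  move=> t; split=> [small|/forallP small i]; last by rewrite smallE.
  by apply/forallP => i; rewrite -smallE; apply: small.
under eq_finset do rewrite negb_forall.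
apply: le_trans (_ : (\sum_(i < n) #|[set s | ~~ small_error v i eps s]%SET|)%N%:R <= _).
  by rewrite ler_nat; apply: card_exists_le.
rewrite natr_sum.
(* Each player gets the failure budget [delta / n], which turns [2 / delta] into [2 * n / delta] in
   the logarithm. *)
apply: le_trans (_ : \sum_(i < n) delta / n%:R * n`!%:R ^+ M <= _).
  apply: ler_sum => i _; apply: card_large_error_saving => //.
    by rewrite divr_gt0 // ltr0n (leq_trans _ (ltn_ord i)).
  by rewrite (_ : 2 / (delta / n%:R) = 2 * n%:R / delta) // invf_div mulrA.
rewrite sumr_const card_ord -[_ *+ n]mulr_natl.
(* With no players the sum of budgets is 0; otherwise the [n] shares add up to [delta]. *)
have [->|n0] := posnP n; first by rewrite mul0r mulr_ge0 ?exprn_ge0 // ltW.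
by rewrite mulrA [n%:R * _]mulrC divfK // pnatr_eq0 -lt0n.
Qed.
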